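(* Any nonadaptive unateness tester (even one with two-sided error) for real-valued functions $f:\{0,1\}^d\to\mathbb{R}$ with distance parameter $\varepsilon=1/8$ must make $\Omega(d\log d)$ queries.
   Context: A function $f:\{0,1\}^d\to\mathbb{R}$ is unate if for every coordinate $i\in[d]$, $f$ is either nonincreasing in the $i$-th coordinate or nondecreasing in the $i$-th coordinate. $f$ is $\varepsilon$-far from unate if at least an $\varepsilon$ fraction of its values must be modified to make it unate. A unateness tester with distance parameter $\varepsilon$ has query access to $f$ and must accept with probability at least $2/3$ if $f$ is unate and reject with probability at least $2/3$ if $f$ is $\varepsilon$-far from unate. A tester is nonadaptive if it chooses all its queries before seeing any answers. *)

(* Defs.v *)
From HB Require Import structures.
From mathcomp Require Import all_boot all_order all_algebra.
From mathcomp Require Import all_classical all_reals all_analysis.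
Set Implicit Arguments.
Unset Strict Implicit.
Unset Printing Implicit Defensive.
Import Order.TTheory GRing.Theory Num.Theory.
Local Open Scope classical_set_scope.
Local Open Scope ring_scope.

Notation cube d := {ffun 'I_d -> bool}.

Definition set_coord (d : nat) (x : cube d) (i : 'I_d) (b : bool) : cube d :=
  [ffun j => if j == i then b else x j].

Section Unateness.
Variables (R : realType) (d : nat).
Implicit Types f g : cube d -> R.

Definition nondecreasing_in f (i : 'I_d) : Prop :=
  forall x, f (set_coord x i false) <= f (set_coord x i true).

Definition nonincreasing_in f (i : 'I_d) : Prop :=
  forall x, f (set_coord x i true) <= f (set_coord x i false).

Definition unate f : Prop :=
  forall i, nonincreasing_in f i \/ nondecreasing_in f i.

Definition fun_dist f g : R :=
  #|[set x : cube d | f x != g x]%SET|%:R / #|{: cube d}|%:R.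

Definition far_from_unate (eps : R) f : Prop :=
  forall g, unate g -> eps <= fun_dist f g.

End Unateness.

(* The randomness of the algorithm is a point w of a measurable space T, which
   carries the law of the random bits. The list of queries depends on w only,
   and not on f: this is nonadaptivity. The verdict (true = accept) is an
   arbitrary function of w (hence of the queries) and of the list of answers. *)
Record nonadaptive_algorithm (R : realType) (d : nat) (disp : measure_display)
    (T : measurableType disp) := NonadaptiveAlgorithm {
  queries : T -> seq (cube d);
  verdict : T -> seq R -> bool;
  measurable_queries : forall s, measurable [set w | queries w = s];
  measurable_verdict : forall a, measurable [set w | verdict w a]
}.

Section Testers.
Variables (R : realType) (d : nat) (disp : measure_display).
Variables (T : measurableType disp).
Implicit Type A : nonadaptive_algorithm R d T.

Definition accepts A (f : cube d -> R) : set T :=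
  [set w | verdict A w (map f (queries A w))].

Lemma measurable_accepts A f : measurable (accepts A f).
Proof.
have -> : accepts A f = \bigcup_(s : seq (cube d))
    ([set w | queries A w = s] `&` [set w | verdict A w (map f s)]).
  apply/seteqP; split=> [w Aw | w [s _ [/= <-]]] //.
  by exists (queries A w).
apply: countable_bigcupT_measurable; first exact: countableP.
move=> s; apply: measurableI; first exact: measurable_queries.
exact: measurable_verdict.
Qed.

Definition unateness_tester (P : probability T R) (eps : R) A : Prop :=
  (forall f, unate f -> ((2 / 3)%:E <= P (accepts A f))%E) /\
  (forall f, far_from_unate eps f -> ((2 / 3)%:E <= P (~` accepts A f))%E).

Definition makes_at_most A (q : nat) : Prop :=
  forall w, (size (queries A w) <= q)%N.

End Testers.

(* Main.v *)
Require Import Defs.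
From HB Require Import structures.
From mathcomp Require Import all_boot all_order all_algebra.
From mathcomp Require Import all_classical all_reals all_analysis.
From mathcomp Require Import zify ring lra.
Import Order.TTheory GRing.Theory Num.Theory.
Local Open Scope ring_scope.
Set Implicit Arguments.
Unset Strict Implicit.
Unset Printing Implicit Defensive.

(* By Ramsey's theorem there is an infinite set of values on which the verdict
   depends, up to a small error, only on the order pattern of the answers.

   Split the coordinates into [t] address bits and [n] body bits, and order the
   points by address first. On the subcube of address [u], a hard function is
   the binary value of the body in which one active coordinate [r_u] carries a
   sign [b_u], where [r_u] belongs to a random set [S] of about [2 ^ k]
   coordinates, and in which the other coordinates of [S] are erased. If [b_u]
   is a function of [r_u] the hard function is unate; if the signs are
   independent it is [1/8]-far from unate with high probability.

   The order pattern on a query set sees [b_u] only if [r_u] is the most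
   significant unerased difference of two queries of address [u], and the two
   distributions look the same unless this happens for two addresses with the
   same active coordinate. As [S] is sparse, [r_u] is then almost always among
   the four most significant differences of the two queries; at most [4 q]
   pairs of an address and a coordinate arise in this way from [q] queries. If
   coordinate [j] arises at [a] addresses, scale [k] contributes at most
   [min(2^k, 2 a^2 / 2^k) / n], which sums to [O(a / n)] over all scales. So
   averaging over [Omega(log n)] scales shows that [q = o(n log n)] queries do
   not suffice. *)

(** * Ramsey's theorem along increasing sequences *)

Definition incr (phi : nat -> nat) := {homo phi : i j / (i < j)%N}.

Lemma incr_comp phi psi : incr phi -> incr psi -> incr (phi \o psi).
Proof. by move=> hf hg i j ij; apply/hf/hg. Qed.

Lemma incr_sorted phi L : incr phi -> sorted ltn L -> sorted ltn (map phi L).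
Proof. by move=> h; apply: homo_sorted. Qed.

Lemma incr_mono phi : incr phi -> {mono phi : i j / (i < j)%N}.
Proof.
move=> h i j; case: (ltngtP i j) => [/h //|/h ji|->]; last by rewrite ltnn.
by apply/negbTE; rewrite -leqNgt ltnW.
Qed.

Lemma infinitely_often_pigeonhole (C : finType) (col : nat -> C) :
  exists c, forall N, exists2 k, (N <= k)%N & col k = c.
Proof.
apply: contrapT => /forallNP H.
have {H} /choice[B HB] : forall c, exists N, forall k, (N <= k)%N -> col k != c.
  move=> c; have /existsNP[N HN] := H c.
  by exists N => k Nk; apply/eqP => kc; apply: HN; exists k.
pose k := \max_c B c.
by have /eqP := HB (col k) k (leq_bigmax _).
Qed.

Lemma infinitely_often_subsequence (P : nat -> Prop) :
  (forall N, exists2 k, (N <= k)%N & P k) ->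
  exists2 sigma, incr sigma & forall k, P (sigma k).
Proof.
move=> H.
have /choice[g Hg] : forall N, exists k, (N <= k)%N /\ P k.
  by move=> N; have [k] := H N; exists k.
pose sigma := fix s k := if k is k'.+1 then g (s k').+1 else g 0%N.
exists sigma; last by case=> [|k]; apply: (Hg _).2.
apply: homo_ltn ltn_trans _ => k; exact: (Hg (sigma k).+1).1.
Qed.

(** Induction on [m]: along a diagonal sequence the colour of an [m.+1]-set depends on its minimum
    only, and the pigeonhole principle then makes that colour constant. *)
Lemma ramsey (m : nat) (C : finType) (c : seq nat -> C) :
  exists2 phi, incr phi &
    exists col, forall L, sorted ltn L -> size L = m -> c (map phi L) = col.
Proof.
elim: m c => [|m IH] c.
  by exists id => //; exists (c [::]) => -[].
(* The set [psi] of candidates is thinned so that the colour of a set starting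
   at its minimum no longer depends on the other elements. *)
have /choice[thin Hthin] : forall psi : nat -> nat, exists tc : (nat -> nat) * C,
    incr tc.1 /\ forall L, sorted ltn L -> size L = m ->
      c (psi 0%N :: map (psi \o succn \o tc.1) L) = tc.2.
  move=> psi.
  have [theta ht [col Hcol]] := IH (fun L => c (psi 0%N :: map (psi \o succn) L)).
  exists (theta, col); split=> // L sL zL.
  by rewrite -(Hcol L sL zL) -map_comp.
pose next psi := psi \o succn \o (thin psi).1.
pose psi_ n := iter n next id.
have next_incr psi : incr psi -> incr (next psi).
  by move=> hp; apply: incr_comp (Hthin psi).1; apply: incr_comp.
have psi_incr n : incr (psi_ n) by elim: n => [|n IHn] //; apply: next_incr.
have psi_sub n k : (n <= k)%N -> forall i, exists j, psi_ k i = psi_ n j.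
  move=> /subnK <-; elim: (k - n)%N => [|p IHp] i; first by exists i.
  have [j Hj] := IHp ((thin (psi_ (p + n)%N)).1 i).+1.
  by exists j; rewrite -Hj.
pose a n := psi_ n 0%N.
have a_incr : incr a.
  apply: homo_ltn ltn_trans _ => n; rewrite /a /= /next /=.
  exact: psi_incr.
pose col n := (thin (psi_ n)).2.
have Hcol n L : sorted ltn (n :: L) -> size L = m -> c (map a (n :: L)) = col n.
  move=> snL zL.
  (* Each [a k] with [k > n] is a value of [psi_ n.+1], since later candidate sets only shrink. *)
  have [L' HL'] : exists L', map a L = map (psi_ n.+1) L'.
    have: all (fun k => (n < k)%N) L by apply: order_path_min snL; exact: ltn_trans.
    elim: (L) => [|k l IHl] /= => [_|/andP[nk /IHl[l' Hl']]]; first by exists [::].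
    have [j Hj] := psi_sub _ _ nk 0%N.
    by exists (j :: l'); rewrite /= Hl'; congr (_ :: _).
  rewrite /= HL'; apply: (Hthin (psi_ n)).2.
    have: sorted ltn (map (psi_ n.+1) L').
      by rewrite -HL'; apply: incr_sorted => //; exact: path_sorted snL.
    rewrite sorted_map; apply: sub_sorted => i j; rewrite /relpre /=.
    by rewrite (incr_mono (psi_incr n.+1)).
  by move: (congr1 size HL'); rewrite !size_map zL.
have [cc Hcc] := infinitely_often_pigeonhole col.
have [sigma hs Hs] := infinitely_often_subsequence Hcc.
exists (a \o sigma); first exact: incr_comp.
exists cc => -[//|k L] sL [zL].
have sL' : sorted ltn (map sigma (k :: L)) by apply: incr_sorted.
by rewrite map_comp /= -(Hs k); apply: Hcol; rewrite ?size_map.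
Qed.

(** Rounding every [p x] down to a multiple of [1 / M] leaves finitely many colours; as [X] is
    finite, one application of Ramsey's theorem serves all [x]. *)
Lemma approximately_homogeneous (R : realType) (m : nat) (X : finType)
    (p : X -> seq nat -> R) (e : R) : 0 < e ->
  (forall x L, 0 <= p x L <= 1) ->
  exists2 phi, incr phi & forall x L L', sorted ltn L -> sorted ltn L' ->
    size L = m -> size L' = m -> p x (map phi L) <= p x (map phi L') + e.
Proof.
move=> e0 p01.
pose M := (Num.truncn e^-1).+1.
have M0 : 0 < M%:R :> R by rewrite ltr0n.
have Me : M%:R^-1 <= e.
  by rewrite invf_ple ?posrE // ltW // truncnS_gt.
pose c L : {ffun X -> 'I_M.+1} := [ffun x => inord (Num.truncn (M%:R * p x L))].
have [phi hp [col Hcol]] := ramsey m c.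
exists phi => // x L L' sL sL' zL zL'.
have cE K : (inord (Num.truncn (M%:R * p x K)) : 'I_M.+1) = Num.truncn (M%:R * p x K) :> nat.
  rewrite inordK // ltnS truncn_le_nat.
  have /andP[_ p1] := p01 x K.
  by rewrite (le_lt_trans (ler_piMr _ p1)) ?ler0n // ltr_nat.
have /(congr1 (fun f : {ffun X -> 'I_M.+1} => val (f x))) :
    c (map phi L) = c (map phi L').
  by rewrite !Hcol.
rewrite !ffunE /= !cE => Etr.
have itv K : (Num.truncn (M%:R * p x K))%:R <= M%:R * p x K
    < (Num.truncn (M%:R * p x K)).+1%:R.
  by apply: truncn_itv; rewrite mulr_ge0 ?ler0n //; case/andP: (p01 x K).
have /andP[_ Lub] := itv (map phi L); have /andP[Llb _] := itv (map phi L').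
apply: (@le_trans _ _ (p x (map phi L') + M%:R^-1)); last by rewrite lerD2l.
rewrite -(ler_pM2l M0) mulrDr mulfV ?gt_eqF //.
rewrite (le_trans (ltW Lub)) // Etr -natr1.
by rewrite lerD2r.
Qed.

(** * First differences between queries *)

Section CaptureSets.
Variable n : nat.
Implicit Types (y : cube n) (Y : seq (cube n)) (D C T : {set 'I_n}) (j : 'I_n).

Definition first_diff D y y' j :=
  [&& j \notin D, y j != y' j
    & [forall i : 'I_n, ((i < j)%N && (i \notin D)) ==> (y i == y' i)]].

Lemma first_diffP D y y' j :
  reflect [/\ j \notin D, y j != y' j
            & forall i : 'I_n, (i < j)%N -> i \notin D -> y i = y' i]
          (first_diff D y y' j).
Proof.
apply: (iffP and3P) => -[jD yj H]; split=> //.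
  by move=> i ij iD; apply/eqP; move/forallP: H => /(_ i); rewrite ij iD.
by apply/forallP => i; apply/implyP => /andP[ij iD]; apply/eqP/H.
Qed.

Lemma first_diffC D y y' j : first_diff D y y' j = first_diff D y' y j.
Proof.
by apply/first_diffP/first_diffP => -[jD yj H]; split; rewrite 1?eq_sym // => i ij iD;
  rewrite H.
Qed.

Lemma first_diff_exists D y y' j : j \notin D -> y j != y' j ->
  exists2 i : 'I_n, (i <= j)%N & first_diff D y y' i.
Proof.
move=> jD yj.
pose P (i : 'I_n) := (i \notin D) && (y i != y' i).
have Pj : P j by rewrite /P jD.
case: (arg_minnP (fun i : 'I_n => i : nat) Pj) => i /andP[iD yi] Hmin.
exists i; first exact: Hmin.
apply/first_diffP; split=> // k ki kD.
apply/eqP/negPn/negP => yk.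
by have := Hmin k; rewrite /P kD yk leqNgt ki => /(_ isT).
Qed.

(* Adding a point to [Y] creates at most one new first difference: the one with
   the point of [Y] sharing the longest prefix with it. *)
Lemma first_diff_cover D Y :
  exists2 T : {set 'I_n}, (#|T| <= size Y)%N &
    forall y y' j, y \in Y -> y' \in Y -> first_diff D y y' j -> j \in T.
Proof.
elim: Y => [|y0 Y [T cT HT]]; first by exists finset.set0; rewrite ?cards0.
pose J (j : 'I_n) := has (fun y => first_diff D y0 y j) Y.
have [j0 Jj0|J0] := pickP J; last first.
  exists T; first exact: leqW.
  have H y j : y \in Y -> first_diff D y0 y j -> j \in T.
    by move=> yY fd; have /hasPn /(_ _ yY) /negP := negbT (J0 j).
  move=> y y' j; rewrite !inE => /orP[/eqP->|yY] /orP[/eqP->|y'Y] fd.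
  - by move: fd => /first_diffP[_]; rewrite eqxx.
  - exact: H fd.
  - by apply: (H y) => //; rewrite first_diffC.
  - exact: HT fd.
case: (arg_maxnP (fun i : 'I_n => i : nat) Jj0) => j1 /hasP[y1 y1Y fd1] Hmax.
exists (j1 |: T)%SET.
  by rewrite cardsU1 /=; case: (_ \notin _); rewrite ?add1n ?add0n ?ltnS // leqW.
have H y j : y \in Y -> first_diff D y0 y j -> j \in (j1 |: T)%SET.
  move=> yY fd; rewrite !inE; case: eqVneq => //= jj1.
  (* Before [j1] the points [y0] and [y1] agree outside [D], so a first difference of [y0] and [y]
     there is also one of [y1] and [y]. *)
  have jlt : (j < j1)%N.
    by rewrite ltn_neqAle jj1 /=; apply: Hmax; apply/hasP; exists y.
  apply: (HT y1 y) => //; move/first_diffP: fd1 => [_ _ H1].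
  move/first_diffP: fd => [jD yj H0]; apply/first_diffP; split=> //.
    by rewrite -H1.
  by move=> i ij iD; rewrite -H1 ?H0 // (ltn_trans ij).
move=> y y' j; rewrite !(in_cons y0) => /orP[/eqP->|yY] /orP[/eqP->|y'Y] fd.
- by move: fd => /first_diffP[_]; rewrite eqxx.
- exact: H fd.
- by apply: (H y) => //; rewrite first_diffC.
- by rewrite inE (HT _ _ _ yY y'Y fd) orbT.
Qed.

Definition diffs_below y y' j :=
  [set i : 'I_n | (i < j)%N && (y i != y' i)]%SET.

(* The cover is obtained by [c] rounds of [first_diff_cover], each of which
   ignores the coordinates that are already covered. *)
Lemma early_diff_cover c Y :
  exists2 C : {set 'I_n}, (#|C| <= c * size Y)%N &
    forall y y' j, y \in Y -> y' \in Y -> y j != y' j -> j \notin C ->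
      (c <= #|diffs_below y y' j|)%N.
Proof.
suff [C cC H] : exists2 C : {set 'I_n}, (#|C| <= c * size Y)%N &
    forall y y' j, y \in Y -> y' \in Y -> y j != y' j -> j \notin C ->
      (c <= #|diffs_below y y' j :&: C|)%N.
  exists C => // y y' j yY y'Y yj jC.
  by apply: leq_trans (H _ _ _ yY y'Y yj jC) (subset_leq_card (subsetIl _ _)).
elim: c => [|c [C cC HC]]; first by exists finset.set0; rewrite ?cards0.
have [T cT HT] := first_diff_cover C Y.
exists (C :|: T)%SET.
  rewrite mulSn addnC; apply: leq_trans (leq_add cC cT).
  by rewrite cardsU leq_subr.
move=> y y' j yY y'Y yj; rewrite inE negb_or => /andP[jC jT].
have [i ij fd] := first_diff_exists jC yj.
have iT := HT _ _ _ yY y'Y fd.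
have ltij : (i < j)%N.
  by rewrite ltn_neqAle ij andbT; apply: contra jT => /eqP /val_inj <-.
move/first_diffP: fd => [iC yi _].
apply: (@leq_trans #|i |: (diffs_below y y' j :&: C)|%SET).
  by rewrite cardsU1 !inE (negbTE iC) andbF add1n ltnS HC.
apply/subset_leq_card/fintype.subsetP => k; rewrite !inE => /orP[/eqP->|/andP[-> ->]] //.
by rewrite ltij yi iT orbT.
Qed.

(** The list depends on the pair and not on [j], so that a union bound over pairs of queries
    suffices. *)
Definition early_diffs c y y' : seq 'I_n :=
  take c [seq i <- enum 'I_n | y i != y' i].

Lemma early_diffs_uniq c y y' : uniq (early_diffs c y y').
Proof. by rewrite take_uniq // filter_uniq // enum_uniq. Qed.

Lemma early_diffs_below c y y' j : (c <= #|diffs_below y y' j|)%N ->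
  size (early_diffs c y y') = c /\
  {in early_diffs c y y', forall i : 'I_n, (i < j)%N && (y i != y' i)}.
Proof.
rewrite /early_diffs; set l := [seq i <- _ | _] => cj.
have count_l : count (fun i : 'I_n => (i < j)%N) l = #|diffs_below y y' j|.
  rewrite count_filter enumT cardE /enum_mem size_filter.
  by apply: eq_count => i /=; rewrite !inE.
have sl : sorted (fun i i' : 'I_n => (i < i')%N) l.
  apply: sorted_filter; first by move=> ? ? ?; exact: ltn_trans.
  by have := iota_ltn_sorted 0 n; rewrite -val_enum_ord sorted_map.
split.
  by rewrite size_takel // (leq_trans cj) // -count_l count_size.
have Hl i : i \in l -> y i != y' i by rewrite mem_filter => /andP[].
move=> i ti; rewrite (Hl _ (mem_take ti)) andbT.
move: cj sl ti; rewrite -count_l; clear; elim: l c => [|a l IHl] [|c] //=.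
have [aj|ja] := ltnP a j.
  rewrite add1n ltnS => cc sl; rewrite inE => /orP[/eqP->//|].
  by apply: IHl => //; exact: path_sorted sl.
rewrite add0n => cc sl _.
suff : count (fun i : 'I_n => (i < j)%N) l = 0%N by move=> E; rewrite E in cc.
apply/eqP; rewrite -leqn0 leqNgt -has_count; apply/hasPn => k kl.
rewrite -leqNgt (leq_trans ja) // ltnW //.
by move/order_path_min: sl => /(_ (fun _ _ _ => @ltn_trans _ _ _)) /allP /(_ k kl).
Qed.

End CaptureSets.

(** * Binary values and erased coordinates *)

Section LexicographicValue.
Variable n : nat.
Implicit Types (y z : cube n) (j : 'I_n).

Definition lexval z : nat := \sum_(j < n) (z j * 2 ^ (n - j.+1)).

Lemma lexval_mono z z' : (forall j, z j ==> z' j) -> (lexval z <= lexval z')%N.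
Proof.
move=> H; apply: leq_sum => j _; rewrite leq_mul2r.
by have := H j; case: (z j); case: (z' j); rewrite ?orbT.
Qed.

Lemma sum_exp2_lt m : (m <= n)%N ->
  (\sum_(i < n | m <= i) 2 ^ (n - i.+1) < 2 ^ (n - m))%N.
Proof.
move=> mn; have -> : (\sum_(i < n | m <= i) 2 ^ (n - i.+1) =
    \sum_(m <= i < n) 2 ^ (n - i.+1))%N by rewrite big_geq_mkord.
move: (subnKC mn) => {mn}; move: (n - m)%N => k; elim: k m => [|k IHk] m.
  by rewrite addn0 => ->; rewrite big_geq.
rewrite addnS -addSn => mk; rewrite big_ltn -?mk ?leq_addr // addKn.
by rewrite mk expnS mul2n -addnn -addnS leq_add2l IHk.
Qed.

Lemma lexval_bound z : (lexval z < 2 ^ n)%N.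
Proof.
have := sum_exp2_lt (leq0n n); rewrite subn0; apply: leq_ltn_trans.
by apply: leq_sum => j _; case: (z j); rewrite ?mul1n.
Qed.

Lemma lexval_lt z z' j : (forall i : 'I_n, (i < j)%N -> z i = z' i) ->
  z j = false -> z' j = true -> (lexval z < lexval z')%N.
Proof.
move=> H zj z'j; rewrite /lexval (bigID (fun i : 'I_n => i < j)%N) /=.
rewrite [X in (_ < X)%N](bigID (fun i : 'I_n => i < j)%N) /=.
rewrite (eq_bigr (fun i : 'I_n => z' i * 2 ^ (n - i.+1))%N); last by move=> i /H->.
rewrite ltn_add2l (bigD1 j) ?ltnn //= zj mul0n add0n.
rewrite [X in (_ < X)%N](bigD1 j) ?ltnn //= z'j mul1n.
apply: leq_trans (leq_addr _ _).
apply: leq_ltn_trans (sum_exp2_lt (ltn_ord j)).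
rewrite [X in (_ <= X)%N](eq_bigl (fun i : 'I_n => ~~ (i < j)%N && (i != j))); last first.
  by move=> i; rewrite -leqNgt ltn_neqAle andbC eq_sym.
by apply: leq_sum => i _; case: (z i); rewrite ?mul1n.
Qed.

Lemma lexval_leE z z' j : (forall i : 'I_n, (i < j)%N -> z i = z' i) ->
  z j != z' j -> (lexval z <= lexval z')%N = z' j.
Proof.
move=> H; case zj: (z j); case z'j: (z' j) => // _.
  by apply/negbTE; rewrite -ltnNge; apply: (@lexval_lt z' z j) => // i /H.
by apply: ltnW; apply: (@lexval_lt z z' j).
Qed.

Lemma lexval_inj : injective lexval.
Proof.
move=> z z' E; apply/ffunP => j; apply/eqP/negPn/negP => zj.
have j0 : j \notin (finset.set0 : {set 'I_n}) by rewrite inE.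
have [i _ /first_diffP[_ zi Hi]] := first_diff_exists j0 zj.
have Hi' (k : 'I_n) : (k < i)%N -> z k = z' k by move=> ki; apply: Hi; rewrite ?inE.
have z'i := lexval_leE Hi' zi; have := zi; rewrite eq_sym => iz.
have := lexval_leE (fun k ki => esym (Hi' k ki)) iz.
by move: z'i; rewrite E leqnn => zi' zi''; rewrite -zi' -zi'' eqxx in zi.
Qed.

(* The other coordinates of [S] are erased so that the function of a subcube is
   constant in a coordinate that another subcube may orient differently. *)
Definition mask (S : {set 'I_n}) (r : 'I_n) (b : bool) y : cube n :=
  [ffun j => if j == r then y j (+) b else (j \notin S) && y j].

(** The first difference outside the erased set [S :\ r] decides the comparison. The sign flips both
    bits at [r], so it matters only if that difference is at [r]. *)
Lemma lexval_mask_le S r b b' y y' :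
  (first_diff (S :\ r)%SET y y' r -> b = b') ->
  (lexval (mask S r b y) <= lexval (mask S r b y'))%N =
  (lexval (mask S r b' y) <= lexval (mask S r b' y'))%N.
Proof.
move=> Hb.
have maskE c w (i : 'I_n) : i \in (S :\ r)%SET -> mask S r c w i = false.
  by rewrite !inE ffunE => /andP[/negbTE-> ->].
have [/existsP[j /andP[jD yj]]|none] :=
  boolP [exists j, (j \notin (S :\ r)%SET) && (y j != y' j)].
  have [i _ fd] := first_diff_exists jD yj.
  have /first_diffP[iD yi Hi] := fd.
  have agree c (k : 'I_n) : (k < i)%N -> mask S r c y k = mask S r c y' k.
    move=> ki; have [kD|kD] := boolP (k \in (S :\ r)%SET); first by rewrite !maskE.
    by rewrite !ffunE Hi.
  have differ c : mask S r c y i != mask S r c y' i.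
    move: iD yi; rewrite !inE !ffunE negb_and negbK.
    by case: (i == r) => /= [_|-> //]; case: (y i); case: (y' i); case: c.
  rewrite (lexval_leE (agree b) (differ b)) (lexval_leE (agree b') (differ b')).
  rewrite !ffunE; case: eqP => // ir.
  by move: fd; rewrite ir => /Hb ->.
have masks c : mask S r c y = mask S r c y'.
  apply/ffunP => k; have [kD|kD] := boolP (k \in (S :\ r)%SET); first by rewrite !maskE.
  move/existsPn: none => /(_ k); rewrite kD /= negbK => /eqP yk.
  by rewrite !ffunE yk.
by rewrite !masks !leqnn.
Qed.

End LexicographicValue.

(** * The hard functions: order patterns, unateness and farness *)

Section HardFunctions.
Variables t n : nat.
Implicit Types (x y : cube (t + n)) (u : cube t).

Definition addr x : cube t := [ffun i => x (lshift n i)].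
Definition body x : cube n := [ffun j => x (rshift t j)].

Lemma addr_set_addr x i b :
  addr (set_coord x (lshift n i) b) = set_coord (addr x) i b.
Proof. by apply/ffunP => k; rewrite !ffunE eq_lshift. Qed.

Lemma addr_set_body x j b : addr (set_coord x (rshift t j) b) = addr x.
Proof. by apply/ffunP => k; rewrite !ffunE eq_lrshift. Qed.

Lemma body_set_body x j b :
  body (set_coord x (rshift t j) b) = set_coord (body x) j b.
Proof. by apply/ffunP => k; rewrite !ffunE eq_rshift. Qed.

Lemma card_cube m : #|{: cube m}| = (2 ^ m)%N.
Proof. by rewrite card_ffun card_bool card_ord. Qed.

Lemma card_addr (P : pred (cube t)) :
  #|[set x | P (addr x)]%SET| = (#|[set u | P u]%SET| * 2 ^ n)%N.
Proof.
pose join (p : cube t * cube n) : cube (t + n) :=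
  [ffun i => match fintype.split i with inl i => p.1 i | inr j => p.2 j end].
have addrK p : addr (join p) = p.1.
  by apply/ffunP => i; rewrite !ffunE -/(unsplit (inl i)) unsplitK.
have bodyK p : body (join p) = p.2.
  by apply/ffunP => i; rewrite !ffunE -/(unsplit (inr i)) unsplitK.
have joinK x : join (addr x, body x) = x.
  by apply/ffunP => i; rewrite ffunE; case: split_ordP => k -> /=; rewrite ffunE.
rewrite -card_cube -cardsT -cardsX.
rewrite -(card_imset (f := join)); last first.
  move=> p p' E; move: (congr1 addr E) (congr1 body E); rewrite !addrK !bodyK.
  by case: p p' {E} => [? ?] [? ?] /= -> ->.
apply: eq_card => x; rewrite inE; apply/idP/imsetP => [Px|[[u w]]].
  by exists (addr x, body x); rewrite ?joinK // !inE Px.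
by rewrite !inE /= andbT => Pu ->; rewrite addrK.
Qed.

(** Body values stay below [2 ^ n], so the address decides first. *)
Definition level (S : {set 'I_n}) (r : cube t -> 'I_n) (b : cube t -> bool) x :=
  (lexval (addr x) * 2 ^ n
   + lexval (mask S (r (addr x)) (b (addr x)) (body x)))%N.

Lemma level_le S r b x y : (level S r b x <= level S r b y)%N =
  (lexval (addr x) < lexval (addr y))%N ||
  (addr x == addr y) &&
  (lexval (mask S (r (addr x)) (b (addr x)) (body x)) <=
   lexval (mask S (r (addr x)) (b (addr x)) (body y)))%N.
Proof.
rewrite /level -(inj_eq (@lexval_inj t)).
have [lt|gt|/(@lexval_inj t)->] := ltngtP; last by rewrite leq_add2l.
  apply/idP; apply: (@leq_trans ((lexval (addr x)).+1 * 2 ^ n)).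
    by rewrite mulSn addnC leq_add2r ltnW ?lexval_bound.
  by apply: leq_trans (leq_addr _ _); rewrite leq_mul2r lt orbT.
apply/negbTE; rewrite -ltnNge; apply: (@leq_trans ((lexval (addr y)).+1 * 2 ^ n)).
  by rewrite mulSn addnC ltn_add2r lexval_bound.
by apply: leq_trans (leq_addr _ _); rewrite leq_mul2r gt orbT.
Qed.

(** These are the addresses whose sign the order of the answers on [s] may reveal. *)
Definition captured (s : seq (cube (t + n))) S (r : cube t -> 'I_n) u :=
  has (fun x => has (fun y => [&& addr x == u, addr y == u
    & first_diff (S :\ r u)%SET (body x) (body y) (r u)]) s) s.

Lemma level_pattern s S r b b' :
  (forall u, captured s S r u -> b u = b' u) ->
  {in s &, forall x y,
    (level S r b x <= level S r b y)%N = (level S r b' x <= level S r b' y)%N}.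
Proof.
move=> Hb x y xs ys; rewrite !level_le; congr (_ || _).
case: eqP => //= uE; apply: lexval_mask_le => fd.
by apply: Hb; apply/hasP; exists x => //; apply/hasP; exists y => //; rewrite uE !eqxx /= -uE.
Qed.

Variables (R : realType) (phi : nat -> nat).
Hypothesis phi_incr : incr phi.

Definition hard S r b x : R := (phi (level S r b x))%:R.

Lemma hard_le S r b x y :
  (hard S r b x <= hard S r b y) = (level S r b x <= level S r b y)%N.
Proof. by rewrite ler_nat leqNgt incr_mono // -leqNgt. Qed.

Lemma hard_lt S r b x y :
  (hard S r b x < hard S r b y) = (level S r b x < level S r b y)%N.
Proof. by rewrite ltr_nat incr_mono. Qed.

(** A coordinate [j] of [S] is erased except at the addresses where it is active, and these all
    carry the sign [beta j]. A body coordinate outside [S] is never active, hence never negated. *)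
Lemma unate_hard (S : {set 'I_n}) (r : cube t -> 'I_n) (beta : 'I_n -> bool) :
  (forall u, r u \in S) ->
  unate (hard S r (beta \o r)).
Proof.
move=> rS i; case: (split_ordP i) => {i} j ->.
  right=> x; rewrite hard_le level_le !addr_set_addr.
  apply/orP; left; apply: (@lexval_lt _ _ _ j); rewrite ?ffunE ?eqxx // => k kj.
  by rewrite !ffunE; case: eqP => // E; rewrite E ltnn in kj.
have [/andP[jS bj]|jS] := boolP ((j \in S) && beta j).
  left=> x; rewrite hard_le level_le !addr_set_body eqxx /=.
  apply/orP; right; apply: lexval_mono => k.
  rewrite !body_set_body !ffunE.
  have [kj|_] := eqVneq k j; last exact: implybb.
  by rewrite kj; case: eqP => [<-|]; rewrite ?bj ?jS.
right=> x; rewrite hard_le level_le !addr_set_body eqxx /=.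
apply/orP; right; apply: lexval_mono => k.
rewrite !body_set_body !ffunE.
have [kj|_] := eqVneq k j; last exact: implybb.
rewrite kj; case: eqP => [jr|]; last by rewrite andbF.
by move: jS; rewrite jr rS /= => /negbTE->.
Qed.

Lemma flip_hard S r b x (j := rshift t (r (addr x))) :
  if b (addr x) then hard S r b (set_coord x j true) < hard S r b (set_coord x j false)
  else hard S r b (set_coord x j false) < hard S r b (set_coord x j true).
Proof.
have lt c c' : c (+) b (addr x) = false -> c' (+) b (addr x) = true ->
    hard S r b (set_coord x j c) < hard S r b (set_coord x j c').
  move=> Hc Hc'; rewrite hard_lt /level !addr_set_body ltn_add2l.
  apply: (@lexval_lt _ _ _ (r (addr x))); rewrite ?body_set_body ?ffunE ?eqxx //.
  move=> k; rewrite !ffunE.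
  by case: eqP => // ->; rewrite ltnn.
by case: ifP => bx; apply: lt; rewrite bx.
Qed.

(** A unate [g] orients every coordinate. Where the sign contradicts this orientation, [f] is
    strictly monotone the wrong way along the active edge, so [g] differs from [f] at an endpoint.
    Such edges cover at least a quarter of the points; one endpoint of each gives [1 / 8]. *)
Lemma far_hard S r b :
  (forall sigma : 'I_n -> bool,
     (2 ^ t <= 4 * #|[set u | b u == sigma (r u)]%SET|)%N) ->
  far_from_unate (1 / 8) (hard S r b).
Proof.
move=> Hb g ug; set f := hard S r b.
(* The sign [true] makes the active coordinate decreasing, so equality with [sigma] is a
   conflict. *)
pose sigma j := `[< nondecreasing_in g (rshift t j) >].
pose flip x := set_coord x (rshift t (r (addr x))) (~~ x (rshift t (r (addr x)))).
have flipK : involutive flip.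
  move=> x; apply/ffunP => k; rewrite /flip addr_set_body !ffunE eqxx negbK.
  by case: eqP => // ->.
pose D := [set x | f x != g x]%SET.
pose B := [set x | b (addr x) == sigma (r (addr x))]%SET.
have BD : B \subset (D :|: flip @: D)%SET.
  apply/fintype.subsetP => x; rewrite !inE => /eqP bs.
  case: eqP => //= fx; apply/imsetP; exists (flip x); last by rewrite flipK.
  rewrite inE; apply/eqP => ffx.
  set j := rshift t (r (addr x)) in flip ffx flipK *.
  have sx : set_coord x j (x j) = x.
    by apply/ffunP => k; rewrite ffunE; case: eqP => // ->.
  have fg c : f (set_coord x j c) = g (set_coord x j c).
    have [->|] := eqVneq c (x j); first by rewrite sx.
    by move: ffx; rewrite /flip -/j; case: c; case: (x j).
  have : if b (addr x) then f (set_coord x j true) < f (set_coord x j false)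
      else f (set_coord x j false) < f (set_coord x j true) := flip_hard S r b x.
  rewrite !fg bs /sigma.
  case: asboolP => [nd|].
    by rewrite ltNge nd.
  by case: (ug j) => // ni _; rewrite ltNge ni.
have cB : (2 ^ (t + n) <= 8 * #|D|)%N.
  have := subset_leq_card BD; rewrite (card_addr (fun u => b u == sigma (r u))).
  have := Hb sigma; set N := #|_|; set Dn := #|D| => HN HB.
  have HD : (#|(D :|: flip @: D)%SET| <= Dn + Dn)%N.
    apply: leq_trans (leq_card_setU _ _) _.
    by rewrite leq_add2l leq_imset_card.
  rewrite expnD (leq_trans (leq_mul HN (leqnn _))) //.
  rewrite -mulnA (leq_trans (leq_mul (leqnn 4) (leq_trans HB HD))) //.
  by rewrite addnn -mul2n mulnA.
rewrite /fun_dist card_cube -/D.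
by rewrite ler_pdivlMr ?ltr0n ?expn_gt0 // mul1r mulrC ler_pdivrMr // -natrM ler_nat mulnC.
Qed.

End HardFunctions.

(** * Averages over uniform finite choices *)

Section Averages.
Variable R : realType.
Implicit Types T U : finType.

Definition avg T (F : T -> R) : R := (\sum_x F x) / #|T|%:R.

Lemma avg_le T (F G : T -> R) : (forall x, F x <= G x) -> avg F <= avg G.
Proof. by move=> H; rewrite ler_wpM2r ?invr_ge0 ?ler0n // ler_sum. Qed.

Lemma eq_avg T (F G : T -> R) : F =1 G -> avg F = avg G.
Proof. by move=> H; congr (_ / _); apply: eq_bigr. Qed.

Lemma avgD T (F G : T -> R) : avg (fun x => F x + G x) = avg F + avg G.
Proof. by rewrite /avg big_split mulrDl. Qed.

Lemma avgZ T c (F : T -> R) : avg (fun x => c * F x) = c * avg F.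
Proof. by rewrite /avg -mulr_sumr mulrA. Qed.

Lemma avg_sum T (I : Type) (s : seq I) (P : pred I) (F : I -> T -> R) :
  avg (fun x => \sum_(i <- s | P i) F i x) = \sum_(i <- s | P i) avg (F i).
Proof. by rewrite /avg exchange_big mulr_suml. Qed.

Lemma avg_const T (c : R) : (0 < #|T|)%N -> avg (fun _ : T => c) = c.
Proof.
move=> T0; have -> : avg (fun _ : T => c) = #|T|%:R * c / #|T|%:R.
  by rewrite /avg sumr_const mulr_natl.
by rewrite mulrAC mulfV ?mul1r // pnatr_eq0 -lt0n.
Qed.

Lemma avg_pair T U (F : T * U -> R) : avg F = avg (fun x => avg (fun y => F (x, y))).
Proof.
rewrite /avg -mulr_suml card_prod natrM invfM mulrA -mulrA [_^-1 * _]mulrC mulrA.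
by congr (_ / _ / _); rewrite pair_big /=; apply: eq_bigr => -[].
Qed.

Lemma avg_inj T (f : T -> T) (F : T -> R) : injective f -> avg (F \o f) = avg F.
Proof. by move=> fi; congr (_ / _); rewrite [RHS](reindex_inj fi). Qed.

Lemma avg_ge0 T (F : T -> R) : (forall x, 0 <= F x) -> 0 <= avg F.
Proof. by move=> H; rewrite mulr_ge0 ?invr_ge0 ?ler0n // sumr_ge0. Qed.

Lemma avg_indicator T (P : pred T) : avg (fun x => (P x)%:R) = #|[pred x | P x]|%:R / #|T|%:R.
Proof. by rewrite /avg -natr_sum -big_mkcond sum1_card. Qed.

End Averages.

Section RandomFunctions.
Variables (R : realType) (X Y : finType).
Implicit Types (f : {ffun X -> Y}) (x : X) (y : Y).

Definition update f x y : {ffun X -> Y} :=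
  [ffun x' => if x' == x then y else f x'].

(** An event that survives changing the value [y] at [x] behaves as if independent of this value, in
    the direction that upper bounds need. *)
Lemma avg_resample x y (P : pred {ffun X -> Y}) :
  (forall f y', f x = y -> P f -> P (update f x y')) ->
  avg (fun f : {ffun X -> Y} => ((f x == y) && P f)%:R : R) <=
  avg (fun f : {ffun X -> Y} => (P f)%:R : R) / #|Y|%:R.
Proof.
move=> HP; rewrite !avg_indicator -mulrA [_^-1 * _]mulrC mulrA.
rewrite ler_pM2r; last by rewrite invr_gt0 ltr0n; apply/card_gt0P; exists [ffun=> y].
have Y0 : (0 < #|Y|)%N by apply/card_gt0P; exists y.
rewrite ler_pdivlMr ?ltr0n // -natrM ler_nat.
(* Overwriting the value at [x], which is known to be [y], is injective. *)
pose A := [set f : {ffun X -> Y} | (f x == y) && P f]%SET.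
have -> : #|[pred f : {ffun X -> Y} | (f x == y) && P f]| = #|A|.
  by apply: eq_card => f; rewrite !inE.
rewrite -cardsT -cardsX -(card_in_imset (f := fun p : {ffun X -> Y} * Y => update p.1 x p.2)).
  apply/subset_leq_card/fintype.subsetP => f /imsetP[[f' y']].
  by rewrite !inE /= andbT => /andP[/eqP fx Pf] ->; apply: HP.
move=> [f y1] [f' y2]; rewrite !inE /= !andbT => /andP[/eqP fx _] /andP[/eqP fx' _] E.
have Ex x' : update f x y1 x' = update f' x y2 x' by rewrite E.
congr pair; last by have := Ex x; rewrite !ffunE eqxx.
apply/ffunP => x'; have [->|xx] := eqVneq x' x; first by rewrite fx.
by have := Ex x'; rewrite !ffunE (negbTE xx).
Qed.

Lemma ffun_card_gt0 : (0 < #|Y|)%N -> (0 < #|{ffun X -> Y}|)%N.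
Proof. by move=> Y0; rewrite card_ffun expn_gt0 Y0. Qed.

Lemma avg_value x y : avg (fun f : {ffun X -> Y} => (f x == y)%:R : R) <= #|Y|%:R^-1.
Proof.
have Y0 : (0 < #|Y|)%N by apply/card_gt0P; exists y.
have := @avg_resample x y xpredT (fun _ _ _ _ => isT).
rewrite avg_const ?ffun_card_gt0 // mul1r; apply: le_trans.
by apply: avg_le => f; rewrite andbT.
Qed.

Lemma avg_value2 x x' y y' : x != x' ->
  avg (fun f : {ffun X -> Y} => ((f x == y) && (f x' == y'))%:R : R) <= #|Y|%:R^-1 ^+ 2.
Proof.
move=> xx; apply: le_trans (avg_resample _) _.
  by move=> f z _ /eqP<-; rewrite ffunE [x' == x]eq_sym (negbTE xx).
by rewrite expr2 ler_wpM2r ?invr_ge0 ?ler0n // avg_value.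
Qed.

(** Union bound over the argument taking the head value [y]. Resampling there keeps the rest of [s]
    in the range, as [s] has no repetition. *)
Lemma avg_codom (s : seq Y) : uniq s ->
  avg (fun f : {ffun X -> Y} => (all [in codom f] s)%:R : R) <= (#|X|%:R / #|Y|%:R) ^+ size s.
Proof.
elim: s => [_|y s IHs /= /andP[ys us]].
  have [Y0|] := posnP #|Y|; last by move=> ?; rewrite /= avg_const ?ffun_card_gt0.
  have [F0|] := posnP #|{ffun X -> Y}|; last by move=> ?; rewrite /= avg_const.
  by rewrite /avg F0 invr0 mulr0 ler01.
rewrite exprS (le_trans _ (ler_wpM2l _ (IHs us))) ?divr_ge0 ?ler0n //.
apply: (@le_trans _ _ (\sum_(x : X)
    avg (fun f : {ffun X -> Y} => ((f x == y) && all [in codom f] s)%:R))).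
  rewrite -avg_sum; apply: avg_le => f.
  have [/andP[/codomP[x yx] sf]|_] := boolP (_ && _); last by rewrite sumr_ge0.
  by rewrite (bigD1 x) //= -yx eqxx sf lerDl sumr_ge0.
apply: (@le_trans _ _ (\sum_(x : X)
    avg (fun f : {ffun X -> Y} => (all [in codom f] s)%:R : R) / #|Y|%:R)).
  apply: ler_sum => x _; apply: avg_resample => f y' fx /allP sf.
  apply/allP => z zs; have /codomP[x' zx] := sf z zs.
  apply/codomP; exists x'; rewrite ffunE; case: eqP => // xx.
  by rewrite -fx -xx -zx zs in ys.
by rewrite sumr_const -[leLHS]mulr_natl -[leRHS]mulrA [_^-1 * _]mulrC.
Qed.

End RandomFunctions.

(** * Random signs and their coupling *)

Section RandomSigns.
Variables (R : realType) (U : finType).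
Implicit Type gamma : {ffun U -> bool}.

(** For distinct [u] and [v], flipping the sign at [u] is a bijection that negates the product. *)
Lemma avg_sign_mul (u v : U) :
  avg (fun gamma : {ffun U -> bool} => (-1) ^+ gamma u * (-1) ^+ gamma v : R) = (u == v)%:R.
Proof.
have G0 : (0 < #|{ffun U -> bool}|)%N by rewrite ffun_card_gt0 // card_bool.
case: eqVneq => [->|uv].
  by rewrite -[RHS](avg_const _ G0); apply: eq_avg => g; rewrite -signr_addb addbb.
pose flip gamma := update gamma u (~~ gamma u).
have flip_inj : injective flip.
  apply: (can_inj (g := flip)) => g; apply/ffunP => w; rewrite !ffunE eqxx negbK.
  by case: eqP => // ->.
rewrite mulr0n; set a := avg _; suff : a = - a by move: a => a; lra.
rewrite {1}/a -(avg_inj _ flip_inj) -[RHS]mulN1r /a -avgZ; apply: eq_avg => g /=.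
by rewrite !ffunE eqxx [v == u]eq_sym (negbTE uv) signrN mulrA mulN1r.
Qed.

Lemma avg_sqr_sum_signs (P : pred U) :
  avg (fun gamma : {ffun U -> bool} => (\sum_(u | P u) (-1) ^+ gamma u) ^+ 2 : R) =
  #|[pred u | P u]|%:R.
Proof.
transitivity (avg (fun gamma : {ffun U -> bool} => \sum_(u | P u) \sum_(v | P v)
    ((-1) ^+ gamma u * (-1) ^+ gamma v) : R)).
  by apply: eq_avg => g; rewrite expr2 mulr_suml; apply: eq_bigr => u _; rewrite mulr_sumr.
rewrite avg_sum -sum1_card natr_sum; apply: eq_bigr => u Pu.
rewrite avg_sum (bigD1 u) //= avg_sign_mul eqxx big1 ?addr0 // => v /andP[_ vu].
by rewrite avg_sign_mul eq_sym (negbTE vu).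
Qed.

Lemma card_agreement (K : nat) (h : U -> 'I_K) (gamma : U -> bool) (tau : 'I_K -> bool) :
  2 * #|[set u | gamma u == tau (h u)]%SET|%:R = #|U|%:R +
    \sum_k (-1) ^+ tau k * \sum_(u | h u == k) (-1) ^+ gamma u :> R.
Proof.
have -> : \sum_k (-1) ^+ tau k * \sum_(u | h u == k) (-1) ^+ gamma u =
    \sum_u (-1) ^+ tau (h u) * (-1) ^+ gamma u :> R.
  rewrite [RHS](partition_big h xpredT) //=; apply: eq_bigr => k _.
  by rewrite mulr_sumr; apply: eq_bigr => u /eqP->.
rewrite -!sum1_card !natr_sum -big_split mulr_sumr big_mkcond /=.
apply: eq_bigr => u _; rewrite inE.
by case: (gamma u); case: (tau (h u)); rewrite /= ?expr0 ?expr1; lra.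
Qed.

(* The deviation [D_k] of every class of [h] has variance at most its size; since
   [|D_k| <= D_k^2 / 40 + 10], Markov's inequality controls the sum of the
   absolute deviations. *)
Lemma agreement_rarely_small (K : nat) (h : U -> 'I_K) :
  (0 < #|U|)%N -> (400 * K <= #|U|)%N ->
  avg (fun gamma : {ffun U -> bool} => (~~ [forall tau : {ffun 'I_K -> bool},
      #|U| <= 4 * #|[set u | gamma u == tau (h u)]%SET|])%N%:R : R) <= 10%:R^-1.
Proof.
move=> U0 HK.
pose D gamma k : R := \sum_(u | h u == k) (-1) ^+ gamma u.
have N0 : 0 < #|U|%:R :> R by rewrite ltr0n.
apply: (@le_trans _ _ (avg (fun gamma : {ffun U -> bool} =>
    2 / #|U|%:R * \sum_k (40%:R^-1 * D gamma k ^+ 2 + 10%:R)))).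
  apply: avg_le => gamma.
  have D0 : 0 <= \sum_k (40%:R^-1 * D gamma k ^+ 2 + 10%:R).
    by apply: sumr_ge0 => k _; have := sqr_ge0 (D gamma k); lra.
  case: (boolP [forall tau, _]) => [_|/forallPn[tau]]; first by rewrite mulr_ge0 ?divr_ge0.
  rewrite -ltnNge -(ltr_nat R) natrM => Htau.
  rewrite mulrAC ler_pdivlMr // mul1r.
  have := card_agreement h gamma tau.
  set S := \sum_k _ => HS.
  have : - S <= \sum_k (40%:R^-1 * D gamma k ^+ 2 + 10%:R).
    rewrite /S -sumrN; apply: ler_sum => k _; rewrite -/(D gamma k).
    have := sqr_ge0 (D gamma k - 20%:R); have := sqr_ge0 (D gamma k + 20%:R).
    by case: (tau k); rewrite ?expr0 ?expr1; nra.
  by move: HS Htau D0; lra.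
rewrite avgZ avg_sum (eq_bigr (fun k => 40%:R^-1 * #|[pred u | h u == k]|%:R + 10%:R)).
  rewrite big_split /= -mulr_sumr sumr_const card_ord.
  have -> : \sum_(k < K) #|[pred u | h u == k]|%:R = #|U|%:R :> R.
    rewrite -natr_sum -sum1_card (partition_big h xpredT) //=.
    by congr (_%:R); apply: eq_bigr => k _; rewrite -sum1_card.
  rewrite mulrAC ler_pdivrMr // -mulr_natr.
  (* The bound is [1 / 20 + 20 * K / #|U|], and both terms are at most [1 / 20]. *)
  have : 400%:R * K%:R <= #|U|%:R :> R by rewrite -natrM ler_nat.
  by lra.
move=> k _; rewrite avgD avg_const; last by rewrite ffun_card_gt0 // card_bool.
by rewrite avgZ avg_sqr_sum_signs.
Qed.

End RandomSigns.

(* The two random sign vectors are exchanged on the captured indices. *)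
Lemma avg_coupling (R : realType) (U J : finType) (cap : pred U) (r : U -> J)
    (A : {ffun J -> bool} -> R) (B : {ffun U -> bool} -> R) (e : R) :
  {in cap &, injective r} ->
  (forall (beta : {ffun J -> bool}) (gamma : {ffun U -> bool}),
     (forall u, cap u -> gamma u = beta (r u)) ->
     A beta <= B gamma + e) ->
  avg A <= avg B + e.
Proof.
move=> ri HAB.
have b0 (T : finType) : (0 < #|{ffun T -> bool}|)%N by rewrite ffun_card_gt0 // card_bool.
pose beta' (p : {ffun J -> bool} * {ffun U -> bool}) : {ffun J -> bool} :=
  [ffun j => if [pick u | cap u && (r u == j)] is Some u then p.2 u else p.1 j].
pose gamma' (p : {ffun J -> bool} * {ffun U -> bool}) : {ffun U -> bool} :=
  [ffun u => if cap u then p.1 (r u) else p.2 u].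
(* The [pick] in [beta'] recovers the only captured [u] with [r u = j], by injectivity of [r] on
   captured indices. *)
have swapK : involutive (fun p => (beta' p, gamma' p)).
  move=> [be ga]; congr pair; apply/ffunP => z; rewrite !ffunE /=.
    by case: pickP => [u /andP[cu /eqP ru]|//]; rewrite ffunE cu /= ru.
  case: ifP => cz; last by rewrite cz.
  case: pickP => [u /andP[cu /eqP ru]|/(_ z)]; last by rewrite cz eqxx.
  by congr (ga _); apply: ri.
have -> : avg A = avg (fun p : {ffun J -> bool} * {ffun U -> bool} => A p.1).
  by rewrite avg_pair; apply: eq_avg => be /=; rewrite avg_const.
have -> : avg B + e = avg (fun p : {ffun J -> bool} * {ffun U -> bool} => B p.2 + e).
  by rewrite avgD avg_pair /= !avg_const // card_prod muln_gt0 !b0.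
rewrite -(avg_inj (fun p => B p.2 + e) (inv_inj swapK)).
apply: avg_le => -[be ga] /=.
by apply: HAB => u cu; rewrite ffunE cu.
Qed.

(** * Collision estimates at one scale and over all scales *)

Lemma sum_min_geometric (R : realType) (a L : nat) :
  \sum_(k < L) Num.min (2 ^+ k) (2 * a%:R ^+ 2 / 2 ^+ k) <= 6 * a%:R :> R.
Proof.
have [->|a0] := posnP a.
  rewrite mulr0; apply: sumr_le0 => k _; rewrite ge_min; apply/orP; right.
  by rewrite expr0n mulr0 mul0r.
have {}a0 : 1 <= a%:R :> R by rewrite ler1n.
move: (a%:R : R) a0 => {}a a1.
set T := \sum_(k < L) _.
(* The terms grow until [2 ^+ k] passes [a], then decay. From there on, each new term is half of the
   reserve [4 * a ^+ 2 / 2 ^+ L]. *)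
have : T <= 2 ^+ L /\ (a <= 2 ^+ L -> T <= 6 * a - 4 * a ^+ 2 / 2 ^+ L).
  rewrite /T {T}; elim: L => [|L [IH1 IH2]].
    by rewrite big_ord0 expr0; split=> // a1'; rewrite divr1; nra.
  rewrite big_ord_recr /= [2 ^+ L.+1]exprS; move: IH1 IH2; set T := \sum_(k < L) _.
  set X : R := 2 ^+ L; have X0 : 0 < X by rewrite exprn_gt0.
  set m := Num.min _ _ => IH1 IH2.
  have m1 : m <= X by rewrite ge_min lexx.
  have m2 : m <= 2 * a ^+ 2 / X by rewrite ge_min lexx orbT.
  split=> [|aX]; first lra.
  have -> : 4 * a ^+ 2 / (2 * X) = 2 * a ^+ 2 / X by field; rewrite gt_eqF.
  have [/IH2|Xa] := leP a X.
    have -> : 4 * a ^+ 2 / X = 2 * a ^+ 2 / X + 2 * a ^+ 2 / X by field; rewrite gt_eqF.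
    lra.
  have : 2 * a ^+ 2 / X <= 4 * a by rewrite ler_pdivrMr //; nra.
  lra.
move=> [T1 T2]; have [/T2|] := leP a (2 ^+ L); last lra.
have : 0 <= 4 * a ^+ 2 / 2 ^+ L by apply: divr_ge0; [apply: mulr_ge0; rewrite ?sqr_ge0|exact: exprn_ge0].
by lra.
Qed.

(** Condition on [h u] and [h v]. They coincide with probability [1 / K], and then one value of
    [rho] must be [y]; otherwise two independent values must. *)
Lemma avg_collision (R : realType) (U Y : finType) (K : nat) (u v : U) (y : Y) :
  (0 < K)%N -> u != v ->
  avg (fun rho : {ffun 'I_K -> Y} => avg (fun h : {ffun U -> 'I_K} =>
    ((rho (h u) == y) && (rho (h v) == y))%:R : R))
  <= (K%:R * #|Y|%:R)^-1 + #|Y|%:R^-1 ^+ 2.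
Proof.
move=> K0 uv.
have K0' : K%:R != 0 :> R by rewrite pnatr_eq0 -lt0n.
pose c (rho : {ffun 'I_K -> Y}) k k' : R := ((rho k == y) && (rho k' == y))%:R.
apply: (@le_trans _ _ (\sum_(k < K) \sum_(k' < K)
    K%:R^-1 ^+ 2 * avg (fun rho : {ffun 'I_K -> Y} => c rho k k'))).
  under eq_bigr do under eq_bigr do rewrite -avgZ.
  under eq_bigr do rewrite -avg_sum.
  rewrite -avg_sum; apply: avg_le => rho.
  apply: (@le_trans _ _ (avg (fun h : {ffun U -> 'I_K} => \sum_(k < K) \sum_(k' < K)
      c rho k k' * ((h u == k) && (h v == k'))%:R))).
    apply: avg_le => h; rewrite (bigD1 (h u)) //= (bigD1 (h v)) //= !eqxx mulr1 -addrA lerDl.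
    by rewrite addr_ge0 ?sumr_ge0 // => k _; rewrite ?sumr_ge0 // => *; rewrite mulr_ge0.
  rewrite avg_sum ler_sum // => k _; rewrite avg_sum ler_sum // => k' _.
  rewrite avgZ mulrC ler_wpM2r ?ler0n //.
  by have := @avg_value2 R _ _ u v k k' uv; rewrite card_ord.
apply: (@le_trans _ _ (\sum_(k < K) \sum_(k' < K)
    K%:R^-1 ^+ 2 * ((k == k')%:R * #|Y|%:R^-1 + #|Y|%:R^-1 ^+ 2))).
  apply: ler_sum => k _; apply: ler_sum => k' _.
  rewrite ler_wpM2l ?exprn_ge0 ?invr_ge0 //.
  case: (eqVneq k k') => [<-|kk].
    rewrite mul1r -[leLHS]addr0 lerD ?exprn_ge0 ?invr_ge0 //.
    rewrite (le_trans _ (avg_value R k y)) //; apply: avg_le => rho.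
    by rewrite /c andbb.
  by rewrite mul0r add0r avg_value2.
under eq_bigr => k _.
  rewrite -mulr_sumr big_split /= sumr_const card_ord (bigD1 k) //= eqxx mul1r big1 ?addr0; last first.
    by move=> i ik; rewrite eq_sym (negbTE ik) mul0r.
  over.
rewrite sumr_const card_ord -[_ ^+ 2 *+ K]mulr_natl -[leLHS]mulr_natl invfM.
rewrite le_eqVlt; apply/orP; left; apply/eqP.
set y1 := #|Y|%:R^-1; set x := K%:R; rewrite -/x in K0'.
by field.
Qed.

(** * The bad event: two captured addresses share their active coordinate *)

Section BadEvent.
Variables (R : realType) (t n : nat) (s : seq (cube (t + n))).

(** The sparse set is the range of [K] independent draws, so that an address can choose its active
    coordinate as [rho (h u)]. *)
Definition support K (rho : {ffun 'I_K -> 'I_n}) : {set 'I_n} := [set j in codom rho]%SET.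

(** This is the injectivity that [avg_coupling] asks for. *)
Definition separated K (rho : {ffun 'I_K -> 'I_n}) (h : {ffun cube t -> 'I_K}) :=
  [forall u, forall v, [&& captured s (support rho) (rho \o h) u,
    captured s (support rho) (rho \o h) v & rho (h u) == rho (h v)] ==> (u == v)].

Definition bodies (u : cube t) := [seq body x | x <- s & addr x == u].

Lemma sum_size_bodies : (\sum_u size (bodies u) = size s)%N.
Proof.
rewrite /bodies; elim: s => [|x s' IHs] /=.
  by rewrite big1.
rewrite -IHs -add1n (eq_bigr (fun u => (addr x == u) + size [seq body x | x <- s' & addr x == u])%N); last first.
  by move=> u _; case: eqP.
rewrite big_split /= (bigD1 (addr x)) //= eqxx big1 ?addn0 // => u.
by rewrite eq_sym => /negbTE->.
Qed.

Variable C : cube t -> {set 'I_n}.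
Hypothesis cover : forall u y y' j, y \in bodies u -> y' \in bodies u ->
  y j != y' j -> j \notin C u -> (4 <= #|diffs_below y y' j|)%N.

Definition erased_pair K (rho : {ffun 'I_K -> 'I_n}) (x y : cube (t + n)) :=
  let l := early_diffs 4 (body x) (body y) in
  (size l == 4) && all [in codom rho] l.

Definition collision K (rho : {ffun 'I_K -> 'I_n}) (h : {ffun cube t -> 'I_K}) j :=
  [exists u, exists v, [&& u != v, j \in C u, j \in C v, rho (h u) == j & rho (h v) == j]].

(** Outside [C u] the two queries have at least four differences before the active coordinate. A
    capture needs all of them erased, hence in the range of [rho]. *)
Lemma captured_cover K (rho : {ffun 'I_K -> 'I_n}) (h : {ffun cube t -> 'I_K}) u :
  captured s (support rho) (rho \o h) u -> rho (h u) \notin C u ->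
  exists x y, [/\ x \in s, y \in s & erased_pair rho x y].
Proof.
move=> /hasP[x xs /hasP[y ys /and3P[/eqP ax /eqP ay /first_diffP[_ xy agree]]]] jC.
exists x, y; split=> //.
have xb : body x \in bodies u by apply: map_f; rewrite mem_filter ax eqxx.
have yb : body y \in bodies u by apply: map_f; rewrite mem_filter ay eqxx.
have [sz below] := early_diffs_below (cover xb yb xy jC).
rewrite /erased_pair sz eqxx; apply/allP => i /below /andP[ij xyi].
have : i \in (support rho :\ rho (h u))%SET.
  by apply/negPn/negP => /(agree i ij) E; rewrite E eqxx in xyi.
by rewrite !inE => /andP[].
Qed.

(** If the shared coordinate escapes the cover of one of the two addresses, four early differences
    are erased; otherwise it is a collision inside both covers. *)
Lemma not_separated K (rho : {ffun 'I_K -> 'I_n}) (h : {ffun cube t -> 'I_K}) :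
  (~~ separated rho h)%:R <=
    \sum_(x <- s) \sum_(y <- s) (erased_pair rho x y)%:R + \sum_j (collision rho h j)%:R :> R.
Proof.
case: (boolP (separated rho h)) => [_|]; first by rewrite addr_ge0 ?sumr_ge0 // => x _; rewrite sumr_ge0.
have erased u : captured s (support rho) (rho \o h) u -> rho (h u) \notin C u ->
    1%:R <= \sum_(x <- s) \sum_(y <- s) (erased_pair rho x y)%:R + \sum_j (collision rho h j)%:R :> R.
  move=> cu /(captured_cover cu)[x [y [xs ys e]]].
  rewrite (big_rem x) //= (big_rem y) //= e -!addrA lerDl !addr_ge0 ?sumr_ge0 // => z _.
  by rewrite sumr_ge0.
move=> /forallPn[u /forallPn[v]]; rewrite negb_imply => /andP[/and3P[cu cv /eqP uv] nuv].
have [uC|] := boolP (rho (h u) \in C u); last exact: erased.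
have [vC|] := boolP (rho (h v) \in C v); last exact: erased.
have col : collision rho h (rho (h u)).
  by apply/existsP; exists u; apply/existsP; exists v; rewrite nuv uC -uv eqxx uv vC.
rewrite (bigD1 (rho (h u))) //= col addrCA lerDl addr_ge0 ?sumr_ge0 // => x _.
by rewrite sumr_ge0.
Qed.

Lemma avg_erased_pair K x y :
  avg (fun rho : {ffun 'I_K -> 'I_n} => (erased_pair rho x y)%:R : R) <= (K%:R / n%:R) ^+ 4.
Proof.
rewrite /erased_pair /=; set l := early_diffs _ _ _.
case: eqP => [l4|_].
  by have := avg_codom R 'I_K (early_diffs_uniq 4 (body x) (body y)); rewrite -/l l4 !card_ord.
apply: (@le_trans _ _ 0); last by rewrite exprn_ge0 // divr_ge0.
by rewrite /avg big1 ?mul0r.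
Qed.

(** The first bound only asks that [j] be in the range of [rho]. The second is a union bound over
    pairs of addresses whose covers contain [j], each costing at most [2 / (K * n)] as [K <= n]. *)
Lemma avg_collision_active K j : (0 < K)%N -> (K <= n)%N ->
  avg (fun rho : {ffun 'I_K -> 'I_n} => avg (fun h : {ffun cube t -> 'I_K} =>
    (collision rho h j)%:R : R)) <=
  n%:R^-1 * Num.min K%:R (2 * #|[set u | j \in C u]%SET|%:R ^+ 2 / K%:R).
Proof.
move=> K0 Kn.
have n0 : 0 < n%:R :> R by rewrite ltr0n (leq_trans K0).
have K0' : 0 < K%:R :> R by rewrite ltr0n.
have F0 : (0 < #|{ffun cube t -> 'I_K}|)%N by rewrite ffun_card_gt0 // card_ord.
rewrite minr_pMr ?invr_ge0 ?(ltW n0) // le_min; apply/andP; split.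
  have := avg_codom R 'I_K (erefl : uniq [:: j]); rewrite expr1 !card_ord mulrC.
  apply: le_trans; apply: avg_le => rho.
  rewrite -[leRHS](avg_const _ F0); apply: avg_le => h; rewrite /= andbT.
  case: (boolP (collision _ _ _)) => // /existsP[u /existsP[v /and5P[_ _ _ /eqP<- _]]].
  by rewrite codom_f.
set A := [set u | j \in C u]%SET.
apply: (@le_trans _ _ (\sum_(u in A) \sum_(v in A | u != v)
   avg (fun rho : {ffun 'I_K -> 'I_n} => avg (fun h : {ffun cube t -> 'I_K} =>
    ((rho (h u) == j) && (rho (h v) == j))%:R : R)))).
  under eq_bigr do rewrite -avg_sum; rewrite -avg_sum; apply: avg_le => rho.
  under eq_bigr do rewrite -avg_sum; rewrite -avg_sum; apply: avg_le => h.
  case: (boolP (collision _ _ _)) => [|_]; last by rewrite sumr_ge0 // => u _; rewrite sumr_ge0.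
  move=> /existsP[u /existsP[v /and5P[uv uA vA hu hv]]].
  rewrite (bigD1 u) ?inE //= (bigD1 v) ?inE ?vA ?uv //= hu hv -addrA lerDl addr_ge0 ?sumr_ge0 // => w _.
  by rewrite sumr_ge0.
have Kn' : K%:R <= n%:R :> R by rewrite ler_nat.
apply: (@le_trans _ _ (\sum_(u in A) \sum_(v in A | u != v) (2 / (K%:R * n%:R)))).
  apply: ler_sum => u _; apply: ler_sum => v /andP[_ uv].
  apply: le_trans (avg_collision _ _ K0 uv) _; rewrite card_ord.
  rewrite (_ : 2 / _ = (K%:R * n%:R)^-1 + (K%:R * n%:R)^-1); last by field; rewrite !gt_eqF.
  by rewrite lerD2l expr2 -invfM lef_pV2 ?posrE ?mulr_gt0 // ler_pM2r.
apply: (@le_trans _ _ (\sum_(u in A) \sum_(v in A) (2 / (K%:R * n%:R)))).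
  apply: ler_sum => u _; rewrite [leRHS](bigID (fun v => u != v)) /= lerDl.
  by apply: sumr_ge0 => v _; rewrite divr_ge0 // mulr_ge0.
rewrite !sumr_const -mulrnA -[leLHS]mulr_natr natrM le_eqVlt; apply/orP; left; apply/eqP.
by field; rewrite !gt_eqF.
Qed.

End BadEvent.

(** At each scale [(2 ^ k) ^ 4 <= n] bounds the erased pairs by [q ^ 2 / n ^ 3]. Collisions at [j]
    are summed over the scales first, giving [6 * a j / n], and the [a j] add up to at most
    [4 * q]. *)
Lemma sum_avg_not_separated (R : realType) (t n L q : nat) (s : seq (cube (t + n))) :
  (2 ^ (4 * L) <= n)%N -> (size s <= q)%N ->
  \sum_(k < L) avg (fun rho : {ffun 'I_(2 ^ k) -> 'I_n} =>
    avg (fun h : {ffun cube t -> 'I_(2 ^ k)} => (~~ separated s rho h)%:R : R))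
  <= L%:R * (q%:R ^+ 2 / n%:R ^+ 3) + 24 * q%:R / n%:R.
Proof.
move=> Ln sq.
have n0 : (0 < n)%N by apply: leq_trans Ln; rewrite expn_gt0.
have n0' : 0 < n%:R :> R by rewrite ltr0n.
have /choice[C HC] : forall u : cube t, exists C : {set 'I_n},
    (#|C| <= 4 * size (bodies s u))%N /\
    forall y y' j, y \in bodies s u -> y' \in bodies s u ->
      y j != y' j -> j \notin C -> (4 <= #|diffs_below y y' j|)%N.
  by move=> u; have [C] := early_diff_cover 4 (bodies s u); exists C.
have cover u := (HC u).2.
pose a j : nat := #|[set u | j \in C u]%SET|.
have sum_a : (\sum_j a j <= 4 * q)%N.
  apply: (@leq_trans (\sum_u 4 * size (bodies s u))); last first.
    by rewrite -big_distrr /= sum_size_bodies leq_mul2l.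
  apply: (@leq_trans (\sum_u #|C u|)); last by apply: leq_sum => u _; exact: (HC u).1.
  rewrite (eq_bigr (fun j => \sum_(u | j \in C u) 1)%N); last first.
    by move=> j _; rewrite /a -sum1_card; apply: eq_bigl => u; rewrite inE.
  rewrite (exchange_big_dep xpredT) //=.
  by apply: leq_sum => u _; rewrite sum1_card.
have step k : (k < L)%N ->
    avg (fun rho : {ffun 'I_(2 ^ k) -> 'I_n} =>
      avg (fun h : {ffun cube t -> 'I_(2 ^ k)} => (~~ separated s rho h)%:R : R))
    <= q%:R ^+ 2 / n%:R ^+ 3 +
       n%:R^-1 * \sum_j Num.min (2 ^+ k) (2 * (a j)%:R ^+ 2 / 2 ^+ k).
  move=> kL.
  have K0 : (0 < 2 ^ k)%N by rewrite expn_gt0.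
  have F0 : (0 < #|{ffun cube t -> 'I_(2 ^ k)}|)%N by rewrite ffun_card_gt0 // card_ord.
  have K4 : ((2 ^ k) ^ 4 <= n)%N.
    by apply: leq_trans Ln; rewrite -expnM leq_exp2l // mulnC leq_mul2l ltnW ?orbT.
  have Kn : (2 ^ k <= n)%N by apply: leq_trans K4; rewrite -[leqLHS]expn1 leq_pexp2l.
  apply: le_trans (avg_le (fun rho => avg_le (fun h => not_separated R cover rho h))) _.
  under eq_avg do rewrite avgD avg_const // avg_sum.
  rewrite avgD !avg_sum; apply: lerD.
    apply: (@le_trans _ _ (\sum_(x <- s) \sum_(y <- s) ((2 ^ k)%:R / n%:R) ^+ 4)).
      by apply: ler_sum => x _; rewrite avg_sum; apply: ler_sum => y _; exact: avg_erased_pair.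
    rewrite !big_const_seq !count_predT !iter_addr_0 -mulrnA -[leLHS]mulr_natl.
    have -> : q%:R ^+ 2 / n%:R ^+ 3 = q%:R ^+ 2 * (n%:R / n%:R ^+ 4) :> R.
      by field; rewrite gt_eqF.
    rewrite natrM -expr2 ler_pM ?exprn_ge0 ?divr_ge0 //.
      by rewrite lerXn2r ?nnegrE // ler_nat.
    by rewrite expr_div_n ler_pM2r ?invr_gt0 ?exprn_gt0 // -natrX ler_nat.
  rewrite mulr_sumr; apply: ler_sum => j _; rewrite -natrX.
  exact: avg_collision_active.
apply: (@le_trans _ _ (\sum_(k < L) (q%:R ^+ 2 / n%:R ^+ 3 +
       n%:R^-1 * \sum_j Num.min (2 ^+ k) (2 * (a j)%:R ^+ 2 / 2 ^+ k)))).
  by apply: ler_sum => k _; exact: step.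
rewrite big_split /= sumr_const card_ord mulr_natl lerD2l -mulr_sumr exchange_big /=.
rewrite mulrC ler_pM2r ?invr_gt0 //.
apply: (@le_trans _ _ (\sum_j 6 * (a j)%:R)).
  by apply: ler_sum => j _; exact: sum_min_geometric.
rewrite -mulr_sumr -natr_sum (_ : 24 * q%:R = 6 * (4 * q)%:R); last by rewrite natrM; lra.
by rewrite ler_pM2l // ler_nat.
Qed.

(** * Order patterns as rankings into increasing lists *)

Lemma extend_sorted (L : seq nat) (m : nat) : sorted ltn L -> (size L <= m)%N ->
  exists L', sorted ltn (L ++ L') /\ size (L ++ L') = m.
Proof.
move=> sL /subnKC zL; exists (iota (\max_(i <- L) i).+1 (m - size L)).
split; last by rewrite size_cat size_iota.
rewrite sorted_pairwise; last exact: ltn_trans.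
rewrite pairwise_cat -!sorted_pairwise; try exact: ltn_trans.
rewrite sL iota_ltn_sorted !andbT; apply/allrelP => i j iL.
by rewrite mem_iota => /andP[+ _]; apply: leq_trans; rewrite ltnS leq_bigmax_seq.
Qed.

(** [L] lists the distinct values of [h] in order and [L'] the matching values of [h'], both padded
    to length [m]; the rank [pi] is shared because the order patterns agree. *)
Lemma common_pattern (X : eqType) (s : seq X) (h h' : X -> nat) (m : nat) :
  {in s &, forall x y, (h x <= h y)%N = (h' x <= h' y)%N} -> (size s <= m)%N ->
  exists pi L L', [/\ sorted ltn L, sorted ltn L', size L = m, size L' = m &
    {in s, forall x, [/\ (pi x < m)%N, h x = nth 0%N L (pi x) & h' x = nth 0%N L' (pi x)]}].
Proof.
move=> hh sm.
have eqh x y : x \in s -> y \in s -> h x = h y -> h' x = h' y.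
  by move=> xs ys E; apply/eqP; rewrite eqn_leq -!hh // E leqnn.
pose g v := if s is x0 :: _ then h' (nth x0 s (find (fun x => h x == v) s)) else 0%N.
have gh x : x \in s -> g (h x) = h' x.
  move=> xs; have hs : has (fun y => h y == h x) s by apply/hasP; exists x.
  rewrite /g; case: (s) xs hs eqh => // x0 s' xs hs eqh.
  by apply: eqh => //; [rewrite mem_nth // -has_find|apply/eqP/(nth_find x0 hs)].
pose M := sort leq (undup (map h s)).
have memM v : (v \in M) = (v \in map h s) by rewrite mem_sort mem_undup.
have sM : sorted ltn M by rewrite ltn_sorted_uniq_leq sort_uniq undup_uniq sort_sorted //; exact: leq_total.
have sgM : sorted ltn (map g M).
  rewrite sorted_map; apply: (@sub_in_sorted _ (mem M)) sM; last exact/allP.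
  move=> v w; rewrite !memM => /mapP[x xs ->] /mapP[y ys ->].
  by rewrite /relpre /= !gh // !ltnNge hh.
have zM : (size M <= m)%N.
  by rewrite size_sort (leq_trans (size_undup _)) // size_map.
have [N [sN zN]] := extend_sorted sM zM.
have [N' [sN' zN']] : exists N', sorted ltn (map g M ++ N') /\ size (map g M ++ N') = m.
  by apply: extend_sorted; rewrite // size_map.
exists (fun x => index (h x) M), (M ++ N), (map g M ++ N'); split=> // x xs.
have iM : (index (h x) M < size M)%N by rewrite index_mem memM map_f.
split; first exact: leq_trans zM.
  by rewrite nth_cat iM nth_index // -index_mem.
by rewrite nth_cat size_map iM (nth_map 0%N) // nth_index ?gh // -index_mem.
Qed.

(** * Comparing the unate and the far distribution *)

Section QueryLowerBound.
Variables (R : realType) (t n q L : nat).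
Local Notation queryseq := (q.-bseq (cube (t + n))).

(* [p s a] is the probability that the queries are [s] and that the answers [a]
   to them are accepted; [w s] is the probability that the queries are [s]. *)
Variables (p : seq (cube (t + n)) -> seq R -> R) (w : seq (cube (t + n)) -> R).
Hypothesis p_ge0 : forall s a, 0 <= p s a.
Hypothesis p_le : forall s a, p s a <= w s.
Hypothesis w_sum : \sum_(s : queryseq) w s = 1.

Let acc (f : cube (t + n) -> R) := \sum_(s : queryseq) p s (map f s).

Hypothesis accept_unate : forall f, unate f -> 2 / 3 <= acc f.
Hypothesis reject_far : forall f, far_from_unate (1 / 8) f -> acc f <= 1 / 3.

Let w_ge0 s : 0 <= w s.
Proof. exact: le_trans (p_le s [::]). Qed.

(** The Ramsey error is chosen to total [1 / 20] over all query sequences. *)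
Let e : R := (20 * #|{: queryseq}|%:R)^-1.

Let e_gt0 : 0 < e.
Proof.
rewrite invr_gt0 mulr_gt0 // ltr0n; apply/card_gt0P.
by exists (bseq_of_tuple [tuple of nseq q [ffun=> false]] : queryseq).
Qed.

Let sum_e : \sum_(s : queryseq) e = 1 / 20.
Proof.
have := e_gt0; rewrite sumr_const -[LHS]mulr_natl /e invr_gt0.
by rewrite pmulr_rgt0 // => x0; field; rewrite gt_eqF.
Qed.

(** There are finitely many pairs of a query sequence and a ranking, so a single [phi] suits them
    all. *)
Lemma pattern_invariance : exists2 phi, incr phi &
  forall (s : queryseq) (h h' : cube (t + n) -> nat),
    {in s &, forall x y, (h x <= h y)%N = (h' x <= h' y)%N} ->
    p s [seq (phi (h x))%:R | x <- s] <= p s [seq (phi (h' x))%:R | x <- s] + e.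
Proof.
(* Using [q.+1] instead of [q] keeps the type of ranks inhabited, as [inord] requires. *)
pose X := (queryseq * {ffun cube (t + n) -> 'I_q.+1})%type.
pose c (x : X) (V : seq nat) := p x.1 [seq (nth 0%N V (x.2 y))%:R | y <- x.1].
have [|phi hp Hphi] := @approximately_homogeneous R q.+1 X c e e_gt0.
  move=> x V; rewrite p_ge0 (le_trans (p_le _ _)) // -w_sum (bigD1 x.1) //= lerDl.
  by apply: sumr_ge0 => y _; exact: w_ge0.
exists phi => // s h h' hh.
have [|pi [V [V' [sV sV' zV zV' HV]]]] := common_pattern (m := q.+1) hh.
  exact: leqW (size_bseq s).
have := Hphi (s, [ffun x => inord (pi x)]) V V' sV sV' zV zV'.
suff -> : c (s, [ffun x => inord (pi x)]) (map phi V) = p s [seq (phi (h x))%:R | x <- s].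
  suff -> : c (s, [ffun x => inord (pi x)]) (map phi V') = p s [seq (phi (h' x))%:R | x <- s] by [].
  congr p; apply/eq_in_map => x xs /=; have [pix _ ->] := HV x xs.
  by rewrite ffunE inordK // (nth_map 0%N) ?zV'.
congr p; apply/eq_in_map => x xs /=; have [pix -> _] := HV x xs.
by rewrite ffunE inordK // (nth_map 0%N) ?zV.
Qed.

Hypothesis nL : (2 ^ (4 * L) <= n)%N.
Hypothesis tL : (400 * 2 ^ L <= 2 ^ t)%N.

(** At every scale the acceptance gap is at least [2 / 3 - 13 / 30]. The Ramsey error explains at
    most [1 / 20] of it, so the bad event must explain the other [11 / 60]. *)
Lemma query_lower_bound :
  L%:R * (11 / 60) <= L%:R * (q%:R ^+ 2 / n%:R ^+ 3) + 24 * q%:R / n%:R :> R.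
Proof.
have [phi phi_incr Hphi] := pattern_invariance.
pose bad K s := avg (fun rho : {ffun 'I_K -> 'I_n} =>
  avg (fun h : {ffun cube t -> 'I_K} => (~~ separated s rho h)%:R : R)).
suff bad_lb k : (k < L)%N -> 11 / 60 <= \sum_(s : queryseq) w s * bad (2 ^ k)%N s.
  have -> : L%:R * (11 / 60) = \sum_(k < L) (11 / 60) :> R.
    by rewrite sumr_const card_ord mulr_natl.
  apply: (@le_trans _ _ (\sum_(k < L) \sum_(s : queryseq) w s * bad (2 ^ k)%N s)).
    by apply: ler_sum => k _; exact: bad_lb.
  rewrite exchange_big /= -[leRHS]mul1r -{1}w_sum mulr_suml.
  apply: ler_sum => s _; rewrite -mulr_sumr ler_wpM2l //.
  exact: sum_avg_not_separated (size_bseq s).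
move=> kL; set K := (2 ^ k)%N.
have n0 : (0 < n)%N by apply: leq_trans nL; rewrite expn_gt0.
have K0 : (0 < K)%N by rewrite expn_gt0.
have KN : (400 * K <= #|{: cube t}|)%N.
  by rewrite card_cube (leq_trans _ tL) // leq_mul2l leq_exp2l // ltnW ?orbT.
have N0 : (0 < #|{: cube t}|)%N by rewrite card_cube expn_gt0.
have H0 : (0 < #|{ffun cube t -> 'I_K}|)%N by rewrite ffun_card_gt0 // card_ord.
have R0 : (0 < #|{ffun 'I_K -> 'I_n}|)%N by rewrite ffun_card_gt0 // card_ord.
have B0 (T : finType) : (0 < #|{ffun T -> bool}|)%N by rewrite ffun_card_gt0 // card_bool.
pose f rho h b := @hard t n R phi (@support n K rho) (rho \o (h : {ffun cube t -> 'I_K})) b.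
pose yes rho h (beta : {ffun 'I_n -> bool}) := f rho h (beta \o (rho \o h)).
pose no rho h (gamma : {ffun cube t -> bool}) := f rho h gamma.
have yes_lb : 2 / 3 <= avg (fun rho => avg (fun h => avg (fun beta => acc (yes rho h beta)))).
  rewrite -[leLHS](avg_const _ R0); apply: avg_le => rho.
  rewrite -[leLHS](avg_const _ H0); apply: avg_le => h.
  rewrite -[leLHS](avg_const _ (B0 'I_n)); apply: avg_le => beta.
  by apply/accept_unate/unate_hard => // u; rewrite inE; exact: codom_f.
(* [13 / 30] is [1 / 3] plus the bound [1 / 10] on the probability that the signs fail the
   hypothesis of [far_hard]. *)
have no_ub : avg (fun rho => avg (fun h => avg (fun gamma => acc (no rho h gamma)))) <= 13 / 30.
  rewrite -[leRHS](avg_const _ R0); apply: avg_le => rho.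
  rewrite -[leRHS](avg_const _ H0); apply: avg_le => h.
  have -> : 13 / 30 = 1 / 3 + 10%:R^-1 :> R by field.
  apply: le_trans (lerD (lexx _) (agreement_rarely_small R h N0 KN)).
  rewrite -[1 / 3](avg_const _ (B0 (cube t))) -avgD; apply: avg_le => gamma.
  case: (boolP [forall tau, _]) => [/forallP bal|_].
    rewrite addr0; apply/reject_far/far_hard => // sigma.
    (* The orientation of coordinates is pulled back along [rho] to the [K] classes of [h]. *)
    have := bal [ffun j => sigma (rho j)]; rewrite card_cube.
    by under eq_finset do rewrite ffunE.
  apply: (@le_trans _ _ 1); last by rewrite /=; lra.
  by rewrite -w_sum; apply: ler_sum => s _; exact: p_le.
have step (s : queryseq) :
    avg (fun rho => avg (fun h => avg (fun beta => p s (map (yes rho h beta) s)))) <=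
    avg (fun rho => avg (fun h => avg (fun gamma => p s (map (no rho h gamma) s)))) +
    (e + w s * bad K s).
  rewrite /bad -avgZ -[e](avg_const _ R0) -!avgD; apply: avg_le => rho.
  rewrite -avgZ -[e](avg_const _ H0) -!avgD; apply: avg_le => h.
  have [sep|_] := boolP (separated s rho h).
    rewrite mulr0 addr0.
    apply: (@avg_coupling _ _ _ (captured s (support rho) (rho \o h)) (rho \o h)).
      move=> u v cu cv /= ruv; apply/eqP.
      by move/forallP: sep => /(_ u) /forallP /(_ v) /implyP; apply; rewrite ruv eqxx andbT; apply/andP.
    move=> beta gamma bg; apply: Hphi; apply: level_pattern => u cu.
    by rewrite bg.
  (* Without separation, the trivial bound by [w s] is charged to the bad event. *)
  rewrite mulr1 (@le_trans _ _ (w s)) //.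
    by rewrite -[leRHS](avg_const _ (B0 'I_n)); apply: avg_le => beta; exact: p_le.
  by rewrite addrA lerDr addr_ge0 ?(ltW e_gt0) // avg_ge0.
have := ler_sum (index_enum _) (fun s (_ : xpredT s) => step s).
rewrite !big_split /= sum_e.
have sumE (T : finType) (F : {ffun 'I_K -> 'I_n} -> {ffun cube t -> 'I_K} -> T -> cube (t + n) -> R) :
   \sum_(s : queryseq) avg (fun rho => avg (fun h => avg (fun x => p s (map (F rho h x) s)))) =
   avg (fun rho => avg (fun h => avg (fun x => acc (F rho h x)))).
  rewrite -avg_sum; apply: eq_avg => rho; rewrite -avg_sum; apply: eq_avg => h.
  by rewrite -avg_sum.
rewrite !sumE; move: yes_lb no_ub; lra.
Qed.

End QueryLowerBound.

(** * From a tester to finite sums *)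

Lemma sum_fine_probability (R : realType) (disp : measure_display)
    (T : measurableType disp) (P : probability T R) (X : finType) (B : X -> set T) :
  (forall x, measurable (B x)) -> trivIset [set: X] B ->
  \sum_x fine (P (B x)) = fine (P (\bigcup_x B x)%classic).
Proof.
move=> mB tB; rewrite sum_fine => [|x _]; last by exact: fin_num_measure.
congr fine; rewrite measure_fin_bigcup //; last exact: finite_finset.
rewrite (fsbig_seq _ _ (index_enum_uniq X)); congr (\sum_(x \in _) _).
by apply/seteqP; split=> x //= _; rewrite mem_index_enum.
Qed.

(** The events [queries A w = s], over the finitely many [s] of length at most [q], partition the
    sample space, so the acceptance probability is a finite sum. *)
Lemma tester_query_bound (R : realType) (t n q L : nat) (disp : measure_display)
    (T : measurableType disp) (P : probability T R)
    (A : nonadaptive_algorithm R (t + n) T) :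
  unateness_tester P (1 / 8) A -> makes_at_most A q ->
  (2 ^ (4 * L) <= n)%N -> (400 * 2 ^ L <= 2 ^ t)%N ->
  L%:R * (11 / 60) <= L%:R * (q%:R ^+ 2 / n%:R ^+ 3) + 24 * q%:R / n%:R :> R.
Proof.
move=> [accU rejF] Aq.
pose Q s : set T := [set w | queries A w = s]%classic.
pose V a : set T := [set w | verdict A w a]%classic.
have mQ s : measurable (Q s) by exact: measurable_queries.
have mQV s a : measurable (Q s `&` V a)%classic.
  by apply: measurableI => //; exact: measurable_verdict.
have finP B : measurable B -> P B \is a fin_num by move=> mB; exact: fin_num_measure.
have leP B B' : measurable B -> measurable B' -> (B `<=` B')%classic -> fine (P B) <= fine (P B').
  by move=> mB mB' BB'; rewrite fine_le ?finP // le_measure ?inE.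
have sumP (B : q.-bseq (cube (t + n)) -> set T) (B' : set T) :
    (forall s, measurable (B s)) -> (forall s, B s `<=` Q s)%classic ->
    (B' = \bigcup_s B s)%classic ->
    \sum_(s : q.-bseq (cube (t + n))) fine (P (B s)) = fine (P B').
  move=> mB BQ ->; apply: sum_fine_probability => //.
  apply/trivIsetP => s s' _ _ /eqP ss; apply/seteqP; split=> // w [/BQ Qs /BQ Qs'].
  by apply: ss; apply/val_inj; rewrite /= -Qs.
have inQ w : exists s : q.-bseq (cube (t + n)), queries A w = s.
  by exists (Bseq (Aq w)).
have accE f : \sum_(s : q.-bseq (cube (t + n))) fine (P (Q s `&` V (map f s))%classic) =
    fine (P (accepts A f)).
  apply: sumP => [s|s w []|] //.
  apply/seteqP; split=> w; first by have [s E] := inQ w; exists s => //; split=> //; rewrite /V /= -E.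
  by move=> [s _ [E]]; rewrite /V /= -E.
apply: (@query_lower_bound R t n q L
    (fun s a => fine (P (Q s `&` V a)%classic)) (fun s => fine (P (Q s)))).
- by move=> s a; rewrite fine_ge0.
- by move=> s a; apply: leP => // w [].
- rewrite (sumP (fun s => Q s) setT) => [|//|s //|].
    by rewrite probability_setT.
  by apply/seteqP; split=> // w _; have [s E] := inQ w; exists s.
- move=> f uf; rewrite accE -lee_fin fineK; first exact: accU.
  exact/finP/measurable_accepts.
- move=> f ff; rewrite accE -lee_fin fineK; last exact/finP/measurable_accepts.
  have := rejF f ff; rewrite probability_setC; last exact: measurable_accepts.
  rewrite -(fineK (finP _ (measurable_accepts A f))) -EFinB !lee_fin; lra.
Qed.

(** * Choice of parameters and conclusion *)

Theorem theorem1p2 (R : realType) :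
  exists2 c : R, 0 < c &
  exists d0 : nat, forall d : nat, (d0 <= d)%N ->
  forall (disp : measure_display) (T : measurableType disp)
         (P : probability T R) (A : nonadaptive_algorithm R d T) (q : nat),
    unateness_tester P (1 / 8) A -> makes_at_most A q ->
    c * (d%:R * ln d%:R) <= q%:R.
Proof.
have c_gt0 : 0 < 18 * 180 :> R by lra.
(* [18] comes from [d <= 3 * n] and [ln d <= 6 * L], and [180] is [24 / (11 / 60 - 1 / 20)]. *)
exists (18 * 180)^-1; first by rewrite invr_gt0.
(* Naming [16 ^ 3] keeps it from being computed in unary. *)
have [m mE] : exists m, m = (16 ^ 3)%N by eexists.
exists (2 * m)%N => d dge disp T P A q.
pose n := d./2; pose t := (d - n)%N.
have ndt : (n <= t)%N by rewrite /t /n -{2}(odd_double_half d) -addnn addnA addnK leq_addl.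
have dE : d = (t + n)%N by rewrite /t subnK // /n -{2}(odd_double_half d) -addnn addnA leq_addl.
have d3n : (d <= 3 * n)%N /\ (0 < m <= n)%N.
  have m0 : (0 < m)%N by rewrite mE expn_gt0.
  by move: dge m0 (odd_double_half d); rewrite -/n; case: (odd d); lia.
move: A ndt d3n {dge}; move: n t dE => n t -> A ndt [d3n /andP[m0 mn]].
have n0 : (0 < n)%N by exact: leq_trans mn.
(* Base [16] gives [2 ^ (4 * L) <= n], while [L] is still of order [ln n]. *)
set L := trunc_log 16 n.
have L3 : (3 <= L)%N by apply: trunc_log_max; rewrite // -mE.
have Ln : (2 ^ (4 * L) <= n)%N by rewrite expnM; exact: trunc_logP.
have nL : (n < 2 ^ (4 * L.+1))%N by rewrite expnM; exact: trunc_log_ltn.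
move=> HA Hq.
have two_exp : (8 * 2 ^ (3 * L) <= 2 ^ (4 * L))%N.
  by rewrite -(expnD 2 3) leq_exp2l; lia.
have tL : (400 * 2 ^ L <= 2 ^ t)%N.
  have Lt : (4 * L <= t)%N.
    by apply: leq_trans ndt; apply: leq_trans Ln; apply: ltnW; exact: ltn_expl.
  apply: (@leq_trans (2 ^ (9 + L))); first by rewrite expnD leq_mul2r orbT.
  by rewrite leq_exp2l //; lia.
have L2n : (20 * L ^ 2 <= n)%N.
  have := ltn_expl L (isT : 1 < 2)%N => LL.
  apply: leq_trans Ln; rewrite (_ : 4 * L = L + L + (L + L))%N; last by lia.
  rewrite !expnD; apply: leq_mul.
    apply: (@leq_trans (2 ^ (3 + 3))) => //.
    by rewrite -expnD leq_exp2l // leq_add.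
  by rewrite -mulnn leq_mul // ltnW.
have := tester_query_bound HA Hq Ln tL.
(* Here [d <= 3 * n < 2 ^ (4 * L + 6)], and [4 * L + 6 <= 6 * L] since [3 <= L]. *)
have ln_d : ln (t + n)%:R <= (6 * L)%:R :> R.
  apply: (@le_trans _ _ (ln (2 ^+ (4 * L + 6)))).
    rewrite ler_ln ?posrE ?exprn_gt0 ?ltr0n ?addn_gt0 ?n0 ?orbT //.
    rewrite -natrX ler_nat (leq_trans d3n) //.
    apply: (@leq_trans (4 * 2 ^ (4 * L.+1))); first by rewrite leq_mul // ltnW.
    by rewrite -(expnD 2 2) leq_exp2l //; lia.
  have ln2 : ln 2 <= 1 :> R.
    by have := @le_ln1Dx R 1; rewrite (_ : 1 + 1 = 2) //; apply; lra.
  rewrite lnXn // -[leLHS]mulr_natr; apply: (@le_trans _ _ (1 * (4 * L + 6)%:R)).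
    by rewrite ler_wpM2r.
  by rewrite mul1r ler_nat; lia.
have ln_ge0 : 0 <= ln (t + n)%:R :> R by rewrite ln_ge0 // ler1n addn_gt0 n0 orbT.
have dln : (t + n)%:R * ln (t + n)%:R <= 18 * (n%:R * L%:R) :> R.
  have -> : 18 * (n%:R * L%:R) = (3 * n)%:R * (6 * L)%:R :> R by rewrite !natrM; ring.
  by rewrite ler_pM ?ler_nat.
have : 20 * L%:R ^+ 2 <= n%:R :> R by rewrite -natrX -natrM ler_nat.
have n0' : 0 < n%:R :> R by rewrite ltr0n.
have L0 : 0 <= L%:R :> R by [].
have q0 : 0 <= q%:R :> R by [].
move: dln; set D := _ * ln _; set x := n%:R; set l := L%:R; set y := q%:R.
rewrite -/x in n0'; rewrite -/l in L0; rewrite -/y in q0.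
move=> dln l2 main; rewrite mulrC ler_pdivrMr //.
suff : x * l <= 180 * y by lra.
(* If [q] exceeds [n * L] the claim is immediate; otherwise [q ^ 2 / n ^ 3] is at most
   [L ^ 2 / n <= 1 / 20]. *)
have [yxl|] := leP y (x * l); last by nra.
have yl : y ^+ 2 / x ^+ 3 <= 1 / 20.
  apply: (@le_trans _ _ ((x * l) ^+ 2 / x ^+ 3)).
    by rewrite ler_pM2r ?invr_gt0 ?exprn_gt0 // lerXn2r ?nnegrE // mulr_ge0 // ltW.
  have -> : (x * l) ^+ 2 / x ^+ 3 = l ^+ 2 / x by field; rewrite gt_eqF.
  by rewrite ler_pdivrMr //; lra.
have {}main : l * (11 / 60) <= l * (1 / 20) + 24 * y / x.
  by apply: le_trans main _; rewrite lerD2r ler_wpM2l.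
have : l * (8 / 60) <= 24 * y / x by lra.
by rewrite ler_pdivlMr //; lra.
Qed.
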